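(* For every simple graph with $n$ vertices and $k\leq n$, $$I(\overline{K}_k)=\binom nk+\sum_{v=2}^{k}\ \sum_{e=\lceil v/2\rceil}^{\binom v2}(-1)^e\binom{n-v}{k-v}\sigma_e^v,$$ and $$I(K_k)=\sigma_{\binom k2}^k .$$
   Context: Graphs are finite and simple. $I(A)(\mathcal{G})$ is the number of (not necessarily induced) subgraphs of $\mathcal{G}$ isomorphic to $A$; $I(K_k)(\mathcal{G})$ is the number of cliques of order $k$ and $I(\overline{K}_k)(\mathcal{G})$ the number of independent sets of order $k$ in $\mathcal{G}$. $|A|$ is the number of edges of $A$ and $cv(A)$ the number of vertices of $A$ connected to its edges. For a graph $\mathcal{G}$, $$\sigma_e^v(\mathcal{G})=\sum_{A\subseteq\mathcal{G},\,cv(A)=v,\,|A|=e}I(A)(\mathcal{G}),$$ the sum being over unlabeled subgraphs (isomorphism classes, without isolated vertices) $A$. The identities are between functions of the graph on $n$ vertices.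
   Formalization: The second identity is stated for k ≠ 1 only: for k = 1 it fails, since I(K_1) = n ≥ 1 while no graph A has cv(A) = 1, so σ_0^1 = 0. *)

(* Defs.v *)
From HB Require Import structures.
From mathcomp Require Import all_boot all_order all_algebra.

Set Implicit Arguments.
Unset Strict Implicit.
Unset Printing Implicit Defensive.

Definition graph_axiom (T : finType) (p : {set T} * {set {set T}}) : bool :=
  [forall f in p.2, (#|f| == 2) && (f \subset p.1)].

(* A finite simple graph whose vertices are taken from [T]; the vertex set may
   be a proper subset of [T], so that the subgraphs of [G : graph T] are
   themselves elements of the finite type [graph T]. *)
Record graph (T : finType) := Graph {
  graph_val : {set T} * {set {set T}};
  graph_valP : graph_axiom graph_val
}.

HB.instance Definition _ (T : finType) := [isSub for @graph_val T].
HB.instance Definition _ (T : finType) := [Finite of graph T by <:].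

Definition vertices (T : finType) (A : graph T) : {set T} := (val A).1.
Definition edges (T : finType) (A : graph T) : {set {set T}} := (val A).2.

Definition subgraph (T : finType) (A G : graph T) : bool :=
  (vertices A \subset vertices G) && (edges A \subset edges G).

Definition graph_iso (T U : finType) (A : graph T) (B : graph U) : bool :=
  [exists f : {ffun {x | x \in vertices A} -> {y | y \in vertices B}},
    [&& injectiveb f, [forall y, y \in codom f] &
        [forall x, forall y,
          ([set val x; val y] \in edges A)
          == ([set val (f x); val (f y)] \in edges B)]]].

(* I(A)(G): subgraphs are not required to be induced. *)
Definition nb_copies (T U : finType) (A : graph U) (G : graph T) : nat :=
  #|[set H : graph T | subgraph H G & graph_iso H A]|.

(* Number of vertices incident to an edge; it is never 1, so that
   [sigma 1 e G = 0] whereas [nb_cliques 1 G = #|vertices G|]. *)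
Definition cv (T : finType) (A : graph T) : nat := #|cover (edges A)|.

Definition no_isolated (T : finType) (A : graph T) : bool :=
  vertices A \subset cover (edges A).

(* One representative of each isomorphism class of subgraphs of [G] without
   isolated vertices; the graph with no vertex at all is one of them. *)
Definition unlabeled_subgraphs (T : finType) (G : graph T) : {set graph T} :=
  let D := [set A : graph T | subgraph A G & no_isolated A] in
  transversal (equivalence_partition (@graph_iso T T) D) D.

(* The upper index of the usual notation comes first. *)
Definition sigma (T : finType) (v e : nat) (G : graph T) : nat :=
  \sum_(A in unlabeled_subgraphs G | (cv A == v) && (#|edges A| == e))
    nb_copies A G.

Definition is_clique (T : finType) (G : graph T) (S : {set T}) : bool :=
  (S \subset vertices G) &&
  [forall x in S, forall y in S, (x != y) ==> ([set x; y] \in edges G)].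

Definition is_independent (T : finType) (G : graph T) (S : {set T}) : bool :=
  (S \subset vertices G) &&
  [forall x in S, forall y in S, [set x; y] \notin edges G].

Definition nb_cliques (T : finType) (k : nat) (G : graph T) : nat :=
  #|[set S : {set T} | is_clique G S & #|S| == k]|.

Definition nb_independent (T : finType) (k : nat) (G : graph T) : nat :=
  #|[set S : {set T} | is_independent G S & #|S| == k]|.

(* Main.v *)
(** A subgraph without isolated vertices is determined by its edge set, and
    isomorphic graphs agree on [cv] and on the number of edges; so summing the
    number of copies over representatives of the isomorphism classes makes
    [sigma v e G] the number of sets of [e] edges of [G] covering exactly [v]
    vertices.  A set of [C(k, 2)] edges covering [k] vertices is complete.  For
    the first identity, the alternating sum of [(-1)^|E|] over all sets [E] of
    edges inside [S] is the indicator of [S] being independent; exchange this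
    sum with the one over the [k]-sets [S], and note that [C(n-v, k-v)] of them
    contain a given vertex set of size [v]. *)
Require Import Defs.
From mathcomp Require Import all_boot all_order all_algebra.

Set Implicit Arguments.
Unset Strict Implicit.
Unset Printing Implicit Defensive.

(** * Isomorphism as an equivalence relation *)

Lemma graph_isoP (T U : finType) (A : graph T) (B : graph U) :
  reflect
    (exists2 f : {x | x \in vertices A} -> {y | y \in vertices B},
       bijective f &
       forall x y, ([set val x; val y] \in edges A)
                   = ([set val (f x); val (f y)] \in edges B))
    (graph_iso A B).
Proof.
apply: (iffP existsP) => [[f /and3P[/injectiveP fI /forallP fS /forallP fE]]|].
  exists f; last by move=> x y; apply/eqP/(forallP (fE x)).
  apply: inj_card_bij fI _; rewrite -(card_codom (f := id)) //.
  apply: leq_trans (_ : #|codom f| <= _); last exact: leq_image_card.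
  by apply/subset_leq_card/subsetP => y _; apply: fS.
case=> f [g fK gK] fE; exists (finfun f); apply/and3P; split.
- by apply/injectiveP => x y; rewrite !ffunE; apply: (can_inj fK).
- by apply/forallP => y; rewrite -[y]gK -(ffunE f) codom_f.
by apply/forallP => x; apply/forallP => y; rewrite !ffunE fE.
Qed.

Lemma graph_iso_refl (T : finType) (A : graph T) : graph_iso A A.
Proof. by apply/graph_isoP; exists id => //; exists id. Qed.

Lemma graph_iso_sym (T U : finType) (A : graph T) (B : graph U) :
  graph_iso A B -> graph_iso B A.
Proof.
case/graph_isoP=> f [g fK gK] fE; apply/graph_isoP.
by exists g => [|x y]; [exists f | rewrite fE !gK].
Qed.

Lemma graph_iso_trans (T U V : finType)
    (A : graph T) (B : graph U) (C : graph V) :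
  graph_iso A B -> graph_iso B C -> graph_iso A C.
Proof.
case/graph_isoP=> f fB fE /graph_isoP[g gB gE]; apply/graph_isoP.
by exists (g \o f) => [|x y]; [apply: bij_comp | rewrite fE gE].
Qed.

Lemma graph_iso_equivalence (T : finType) :
  equivalence_rel (@graph_iso T T).
Proof.
move=> A B C; split=> [|AB]; first exact: graph_iso_refl.
by apply/idP/idP; apply: graph_iso_trans; rewrite // graph_iso_sym.
Qed.

(** * Edges, covered vertices and isomorphism invariants *)

Lemma card_edge (T : finType) (A : graph T) f : f \in edges A -> #|f| = 2.
Proof.
by move=> fA; case/andP: (forall_inP (valP A) f fA) => /eqP.
Qed.

Lemma edge_sub (T : finType) (A : graph T) f :
  f \in edges A -> f \subset vertices A.
Proof. by move=> fA; case/andP: (forall_inP (valP A) f fA). Qed.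

Lemma cover_edges_sub (T : finType) (A : graph T) :
  cover (edges A) \subset vertices A.
Proof. by apply/bigcupsP => f; apply: edge_sub. Qed.

Lemma no_isolatedE (T : finType) (A : graph T) :
  no_isolated A -> vertices A = cover (edges A).
Proof. by move=> nA; apply/eqP; rewrite eqEsubset cover_edges_sub andbT. Qed.

(** The bijection sends edges to edges injectively, and covered vertices to covered vertices.
    Inequalities suffice here: the inverse isomorphism supplies the reverse ones. *)
Lemma graph_iso_leq (T U : finType) (A : graph T) (B : graph U) :
  graph_iso A B ->
  [/\ #|edges A| <= #|edges B|, cv A <= cv B & no_isolated A -> no_isolated B].
Proof.
case/graph_isoP=> f fB fE; have fI := bij_inj fB.
(* [h] takes images under [f], forgetting the elements outside [vertices A]; hence cardinality is
   preserved only for subsets of [vertices A]. *)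
pose h (X : {set T}) : {set U} :=
  [set val (f x) | x : {x | x \in vertices A} & val x \in X].
have hE (X : {set T}) x : (val (f x) \in h X) = (val x \in X).
  apply/imsetP/idP => [[y]|xX]; last by exists x; rewrite ?inE.
  by rewrite inE => yX /val_inj/fI->.
have h_edge (e : {set T}) : e \in edges A -> h e \in edges B.
  move=> eA; have /cards2P[a [b [_ def_e]]]: #|e| == 2 by rewrite (card_edge eA).
  have /subsetP eV := edge_sub eA.
  have aV : a \in vertices A by rewrite eV // def_e set21.
  have bV : b \in vertices A by rewrite eV // def_e set22.
  suff ->: h e = [set val (f (exist _ a aV)); val (f (exist _ b bV))].
    by rewrite -fE -def_e.
  apply/setP => y; rewrite !inE; apply/imsetP/orP.
    case=> x; rewrite inE def_e !inE => + -> => /orP[] /eqP xE; [left|right];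
    by apply/eqP; congr (val (f _)); apply: val_inj.
  by case=> /eqP->; [exists (exist _ a aV) | exists (exist _ b bV)];
    rewrite // inE def_e ?set21 ?set22.
have h_card (X : {set T}) : X \subset vertices A -> #|h X| = #|X|.
  move=> /subsetP XV; rewrite card_imset; last by move=> x y /val_inj/fI.
  rewrite -(card_imset _ val_inj); apply: eq_card => x.
  apply/imsetP/idP => [[y + ->]|xX]; first by rewrite inE.
  by exists (exist _ x (XV x xX)); rewrite ?inE.
have h_cover x : (val x \in cover (edges A)) -> val (f x) \in cover (edges B).
  by case/bigcupP => e eA xe; apply/bigcupP; exists (h e); rewrite ?h_edge ?hE.
split.
- rewrite -(card_in_imset (f := h) (D := mem (edges A))).
    by apply/subset_leq_card/subsetP => _ /imsetP[e eA ->]; apply: h_edge.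
  (* Equal images only compare points of [vertices A], but an edge contains no other points. *)
  move=> e e' eA e'A /setP ee'; apply/setP => x.
  have [xV|xNV] := boolP (x \in vertices A).
    by have := ee' (val (f (exist _ x xV))); rewrite !hE.
  by rewrite !(contraNF (subsetP (edge_sub _) x) xNV).
- rewrite /cv -h_card ?cover_edges_sub //; apply/subset_leq_card/subsetP.
  by move=> _ /imsetP[x + ->]; rewrite inE; apply: h_cover.
move=> /subsetP nA; apply/subsetP => y yB; have [g _ gK] := fB.
by have := h_cover _ (nA _ (valP (g (exist _ y yB)))); rewrite gK.
Qed.

Lemma graph_iso_card_edges (T U : finType) (A : graph T) (B : graph U) :
  graph_iso A B -> #|edges A| = #|edges B|.
Proof.
move=> AB; apply/eqP; rewrite eqn_leq.
have [-> _ _] := graph_iso_leq AB.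
by have [-> _ _] := graph_iso_leq (graph_iso_sym AB).
Qed.

Lemma graph_iso_cv (T U : finType) (A : graph T) (B : graph U) :
  graph_iso A B -> cv A = cv B.
Proof.
move=> AB; apply/eqP; rewrite eqn_leq.
have [_ -> _] := graph_iso_leq AB.
by have [_ -> _] := graph_iso_leq (graph_iso_sym AB).
Qed.

(** * Counting over isomorphism classes *)

(** After exchanging the sums, each [y] in [D] with [P y] is counted once: its class meets the
    transversal in a single point, and [P] is constant on classes. *)
Lemma sum_transversal_card (T : finType) (R : rel T) (D : {set T}) (P : pred T) :
    {in D & &, equivalence_rel R} -> {in D &, forall x y, R x y -> P x = P y} ->
  (\sum_(x in transversal (equivalence_partition R D) D | P x)
     #|[set y in D | R x y]|) = #|[set y in D | P y]|.
Proof.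
move=> eqR PR; set Q := equivalence_partition R D; set X := transversal Q D.
have partQ : partition Q D := equivalence_partitionP eqR.
have trX : is_transversal X Q D := transversalP partQ.
have XD : {subset X <= D} := subsetP (transversal_sub trX).
transitivity (\sum_(x in X | P x) \sum_(y in D | R x y) 1).
  by apply: eq_bigr => x _; rewrite sum1dep_card.
rewrite (exchange_big_dep (fun y => (y \in D) && P y)) /=; last first.
  by move=> x y /andP[xX Px] /andP[yD xy]; rewrite yD -(PR x) // XD.
rewrite -sum1dep_card; apply: eq_bigr => y /andP[yD Py].
have QB : pblock Q y \in Q by rewrite pblock_mem // (cover_partition partQ).
pose x0 := transversal_repr y X (pblock Q y).
rewrite (big_pred1 x0) // => x; rewrite /= -[RHS]in_set1.
rewrite -(setI_transversal_pblock trX y QB) inE yD /=.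
have [xX|//] := boolP (x \in X); have xD := XD x xX.
rewrite /= (pblock_equivalence_partition eqR) //.
have Rsym : R y x = R x y.
  apply/idP/idP => Rr.
    by have [Ryy /(_ Rr) <-] := eqR _ _ _ yD xD yD.
  by have [Rxx /(_ Rr) <-] := eqR _ _ _ xD yD xD.
by rewrite Rsym; case Rxy: (R x y); rewrite ?andbF // (PR x y) // Py.
Qed.

Lemma sigmaE (T : finType) (v e : nat) (G : graph T) :
  sigma v e G =
  #|[set E : {set {set T}} | [&& E \subset edges G, #|cover E| == v & #|E| == e]]|.
Proof.
rewrite /sigma /unlabeled_subgraphs; set D := [set A | _].
pose P (A : graph T) := (cv A == v) && (#|edges A| == e).
(* A copy of [A] has no isolated vertex either, so all the copies counted by [nb_copies] lie in
   [D]. *)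
have isoD A : A \in D -> #|[set H in D | graph_iso A H]| = nb_copies A G.
  rewrite inE => /andP[_ nA]; apply: eq_card => H; rewrite !inE.
  apply/andP/andP => [[/andP[-> _] /graph_iso_sym//]|[-> HA]].
  have AH := graph_iso_sym HA; split=> //.
  by have [_ _ ->] := graph_iso_leq AH.
have isoP : {in D &, forall A B, graph_iso A B -> P A = P B}.
  by move=> A B _ _ AB; rewrite /P (graph_iso_cv AB) (graph_iso_card_edges AB).
have eqD : {in D & &, equivalence_rel (@graph_iso T T)}.
  by move=> A B C _ _ _; apply: graph_iso_equivalence.
have trD := transversalP (equivalence_partitionP eqD).
transitivity #|[set H in D | P H]|.
  rewrite -(sum_transversal_card eqD isoP); apply: eq_bigr => A /andP[XA _].
  by rewrite isoD // (subsetP (transversal_sub trD)).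
have edges_inj : {in [set H in D | P H] &, injective (@edges T)}.
  move=> A B; rewrite !inE => /andP[/andP[_ nA] _] /andP[/andP[_ nB] _] AB.
  apply: val_inj; rewrite [LHS]surjective_pairing [RHS]surjective_pairing.
  by congr pair => //; rewrite -!/(vertices _) !no_isolatedE // AB.
rewrite -(card_in_imset edges_inj); apply: eq_card => E; rewrite inE.
apply/imsetP/and3P => [[A + ->]|[EG cE eE]].
  by rewrite !inE => /andP[/andP[/andP[_ ->] _] /andP[]].
(* Every admissible edge set arises from the graph whose vertex set is its cover. *)
have AP : graph_axiom (cover E, E).
  apply/forall_inP => f fE.
  by rewrite (card_edge (subsetP EG _ fE)) eqxx bigcup_sup.
exists (Graph AP) => //.
rewrite !inE /P /cv /subgraph /no_isolated /vertices /edges /= EG cE eE subxx.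
rewrite !andbT; apply: subset_trans (cover_edges_sub G).
by apply/bigcupsP => f /(subsetP EG) fG; apply: bigcup_sup.
Qed.

(** * Covers of sets of edges and bounds on their sizes *)

Lemma cover_sub (T : finType) (E : {set {set T}}) (S : {set T}) :
  (cover E \subset S) = (E \subset powerset S).
Proof.
apply/bigcupsP/subsetP => ES f fE; first by rewrite powersetE ES.
by rewrite -powersetE ES.
Qed.

(** Adding [C] is a bijection from the subsets of [V :\: C] of size [k - #|C|]. Without [#|C| <= k]
    the family would be empty, while truncated subtraction would make the binomial 1. *)
Lemma card_between (T : finType) (C V : {set T}) (k : nat) :
  C \subset V -> #|C| <= k ->
  #|[set S : {set T} | [&& C \subset S, S \subset V & #|S| == k]]|
  = 'C(#|V| - #|C|, k - #|C|).
Proof.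
move=> CV Ck; rewrite -cardsDS // -cards_draws.
have addC_inj : {in [set A : {set T} | A \subset V :\: C & #|A| == k - #|C|] &,
    injective (setU C)}.
  move=> A B; rewrite !inE !subsetD => /andP[/andP[_ AC] _] /andP[/andP[_ BC] _].
  move/(congr1 (fun X : {set T} => X :\: C)); rewrite !setDUl !setDv !set0U.
  by rewrite !(setDidPl _).
rewrite -(card_in_imset addC_inj).
apply: eq_card => S; apply/idP/imsetP.
  rewrite inE => /and3P[CS SV /eqP Sk]; exists (S :\: C).
    by rewrite !inE setSD //= cardsDS // Sk.
  by rewrite -[LHS](setID S C) (setIidPr CS).
case=> A; rewrite !inE subsetD => /andP[/andP[AV AC] /eqP Ak] ->.
rewrite subsetUl subUset CV AV /= cardsU disjoint_setI0 1?disjoint_sym //.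
by rewrite cards0 subn0 Ak subnKC.
Qed.

Lemma is_independentE (T : finType) (G : graph T) (S : {set T}) :
  S \subset vertices G ->
  is_independent G S = (edges G :&: powerset S == set0).
Proof.
move=> SV; rewrite /is_independent SV /=.
apply/forall_inP/eqP => [indS|G0 x xS].
  apply/setP => f; rewrite !inE; apply/negP => /andP[fG fS].
  have /cards2P[x [y [_ fE]]]: #|f| == 2 by rewrite (card_edge fG).
  move: fS; rewrite fE subUset !sub1set => /andP[xS yS].
  by have /forall_inP/(_ y yS) := indS x xS; rewrite -fE fG.
(* The case [x = y] is included: the singleton [[set x; x]] is also a subset of [S]. *)
apply/forall_inP => y yS; have /setP/(_ [set x; y]) := G0.
by rewrite in_setI powersetE subUset !sub1set xS yS in_set0 !andbT => ->.
Qed.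

(** Each edge covers only two vertices. This gives the lower end of the range of [e]. *)
Lemma uphalf_cover_leq (T : finType) (G : graph T) (E : {set {set T}}) :
  E \subset edges G -> uphalf #|cover E| <= #|E|.
Proof.
move=> /subsetP EG; rewrite leq_uphalf_double -muln2.
apply: leq_trans (leq_card_cover E) _; rewrite -sum_nat_const.
by apply: leq_sum => f /EG/card_edge ->.
Qed.

Lemma sub_edges_pairs (T : finType) (G : graph T) (E : {set {set T}}) :
  E \subset edges G -> E \subset [set f : {set T} | f \subset cover E & #|f| == 2].
Proof.
move=> /subsetP EG; apply/subsetP => f fE.
by rewrite inE (card_edge (EG f fE)) eqxx bigcup_sup.
Qed.

(** Edges are pairs of covered vertices. This gives the upper end of the range of [e]. *)
Lemma card_sub_edges_leq (T : finType) (G : graph T) (E : {set {set T}}) :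
  E \subset edges G -> #|E| <= 'C(#|cover E|, 2).
Proof. by move/sub_edges_pairs/subset_leq_card; rewrite cards_draws. Qed.

(** [cover] is a bijection from the edge sets counted by [sigma] onto the cliques, with inverse
    taking all pairs in a clique. For [k = 1] this breaks down: a single vertex is a clique that no
    edge set covers exactly. *)
Lemma nb_cliques_sigma (T : finType) (G : graph T) (k : nat) :
  k <> 1%N -> nb_cliques k G = sigma k 'C(k, 2) G.
Proof.
move=> k1; rewrite /nb_cliques sigmaE.
set F := [set E : {set {set T}} | _].
have FE (E : {set {set T}}) : E \in F ->
    E = [set f : {set T} | f \subset cover E & #|f| == 2].
  rewrite inE => /and3P[EG /eqP cE /eqP eE].
  by apply/eqP; rewrite eqEcard (sub_edges_pairs EG) /= cards_draws cE eE.
have cover_inj : {in F &, injective (@cover T)}.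
  by move=> E E' /FE EE /FE EE' cE; rewrite [LHS]EE cE -EE'.
rewrite -(card_in_imset cover_inj); apply: eq_card => S.
apply/idP/imsetP => [|[E EF ->]].
  rewrite inE => /andP[/andP[SV /forall_inP clS] /eqP Sk].
  have cS : S = cover [set f : {set T} | f \subset S & #|f| == 2].
    apply/eqP; rewrite eqEsubset; apply/andP; split.
      (* A point of [S] is covered only if it has a partner in [S]; [k <> 1] provides one. *)
      apply/subsetP => x xS.
      have : S :\ x != set0.
        rewrite -card_gt0 cardsDS ?sub1set // cards1 Sk subn_gt0.
        have : 0 < k by rewrite -Sk card_gt0; apply/set0Pn; exists x.
        by case: (k) k1 => [|[]].
      case/set0Pn=> y; rewrite !inE => /andP[yx yS].
      apply/bigcupP; exists [set x; y]; last by rewrite set21.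
      by rewrite inE subUset !sub1set xS yS cards2 [x == y]eq_sym yx.
    by apply/bigcupsP => f; rewrite inE => /andP[].
  exists [set f : {set T} | f \subset S & #|f| == 2] => //.
  rewrite inE -cS cards_draws Sk !eqxx !andbT; apply/subsetP => f.
  rewrite inE => /andP[fS /cards2P[x [y [xy fE]]]]; move: fS.
  rewrite fE subUset !sub1set => /andP[xS yS].
  by have /forall_inP/(_ y yS)/implyP := clS x xS; apply.
have EE := FE E EF; move: EF; rewrite !inE => /and3P[EG -> _]; rewrite andbT.
apply/andP; split; first by apply/bigcupsP => f /(subsetP EG)/edge_sub.
apply/forall_inP => x xE; apply/forall_inP => y yE; apply/implyP => xy.
by apply: (subsetP EG); rewrite EE inE subUset !sub1set xE yE cards2 xy.
Qed.

(** * Inclusion-exclusion over sets of edges *)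

Import GRing.Theory.
Local Open Scope ring_scope.

(** Expand the product of the factors [a i + 1], where [a i] is -1 on [X] and 0 elsewhere: any
    element of [X] gives a zero factor, and only the subsets of [X] survive in the expansion. *)
Lemma sum_sign_subsets (R : comPzRingType) (I : finType) (X : {set I}) :
  \sum_(E : {set I} | E \subset X) (-1) ^+ #|E| = (X == set0)%:R :> R.
Proof.
have -> : (X == set0)%:R = \prod_i ((if i \in X then -1 else 0) + 1) :> R.
  have [->|/set0Pn[i iX]] := eqVneq.
    by rewrite big1 // => i _; rewrite inE add0r.
  by rewrite (bigD1 i) //= iX addNr mul0r.
rewrite bigA_distr big_mkcond; apply: eq_bigr => E _.
case: ifPn => [/subsetP EX|/subsetPn[i iE iX]].
  rewrite -prodr_const big_mkcond; apply: eq_bigr => i _.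
  by case: ifP => // /EX ->.
by rewrite (bigD1 i) //= iE (negPf iX) mul0r.
Qed.

Lemma nb_independent_sum (T : finType) (G : graph T) (k : nat) :
  (nb_independent k G)%:Z =
  \sum_(E : {set {set T}} | (E \subset edges G) && (#|cover E| <= k)%N)
    (-1) ^+ #|E| * 'C(#|vertices G| - #|cover E|, k - #|cover E|)%:Z.
Proof.
transitivity (\sum_(S : {set T} | (S \subset vertices G) && (#|S| == k))
    \sum_(E : {set {set T}} | E \subset edges G :&: powerset S) (-1) ^+ #|E| : int).
  rewrite -natz /nb_independent -sum1_card natr_sum big_mkcond [RHS]big_mkcond.
  apply: eq_bigr => S _; rewrite inE sum_sign_subsets /=.
  have [SV|SNV] := boolP (S \subset _); last by rewrite /is_independent (negPf SNV).
  by rewrite is_independentE //; case: eqP; case: eqP.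
(* Only edge sets whose cover fits in some [k]-set occur, whence the bound on [#|cover E|], which
   [card_between] then requires. *)
rewrite (exchange_big_dep
  (fun E : {set {set T}} => (E \subset edges G) && (#|cover E| <= k)%N))
  /=; last first.
  move=> S E /andP[_ /eqP <-]; rewrite subsetI -cover_sub => /andP[-> ES].
  exact: subset_leq_card.
apply: eq_bigr => E /andP[EG Ek].
have EV : cover E \subset vertices G.
  by apply/bigcupsP => f /(subsetP EG)/edge_sub.
rewrite -card_between // sumr_const -mulr_natr natz; congr (_ * _%:Z).
apply: eq_card => S; rewrite !inE unfold_in /= subsetI EG -cover_sub /=.
by case: (cover E \subset S); rewrite ?andbT ?andbF.
Qed.

Theorem proposition15 (T : finType) (G : graph T) (n k : nat)
  (hn : #|vertices G| = n) (hk : (k <= n)%N) :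
  (nb_independent k G)%:Z =
    'C(n, k)%:Z
    + \sum_(2 <= v < k.+1) \sum_(uphalf v <= e < 'C(v, 2).+1)
        (-1) ^+ e * 'C(n - v, k - v)%:Z * (sigma v e G)%:Z
  /\ (k <> 1%N -> nb_cliques k G = sigma k 'C(k, 2) G).
Proof.
split; last exact: nb_cliques_sigma.
(* The empty edge set contributes the isolated term ['C(n, k)]. *)
rewrite nb_independent_sum hn (bigD1 set0) /=; last first.
  by rewrite sub0set /cover big_set0 cards0.
congr (_ + _).
  by rewrite /cover big_set0 !cards0 expr0 mul1r !subn0.
pose c (v e : nat) : int := (-1) ^+ e * 'C(n - v, k - v)%:Z.
transitivity (\sum_(2 <= v < k.+1) \sum_(uphalf v <= e < 'C(v, 2).+1)
    \sum_(E : {set {set T}} | [&& E \subset edges G, #|cover E| == v & #|E| == e])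
      c #|cover E| #|E|); last first.
  apply: eq_bigr => v _; apply: eq_bigr => e _; rewrite sigmaE.
  rewrite (eq_bigr (fun _ => c v e)) => [|E /and3P[_ /eqP-> /eqP->]] //.
  rewrite sumr_const -mulr_natr natz; congr (_ * _%:Z).
  by apply: eq_card => E; rewrite inE.
(* Bring the sum over [E] outermost; for fixed [E] the double sum then reduces to the term
   [v = #|cover E|], [e = #|E|], provided that it lies in range. *)
under [RHS]eq_bigr => v _ do
  (rewrite (exchange_big_dep (fun E : {set {set T}} => E \subset edges G)) /=;
   last by move=> e E _ /andP[]).
rewrite (exchange_big_dep (fun E : {set {set T}} => E \subset edges G)) //=.
rewrite big_mkcond [RHS]big_mkcond; apply: eq_bigr => E _ /=.
have [EG|//] := boolP (E \subset edges G).
transitivity (\sum_(2 <= v < k.+1 | v == #|cover E|)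
   \sum_(uphalf v <= e < 'C(v, 2).+1 | e == #|E|) c v e); last first.
  rewrite big_mkcond; apply: eq_bigr => v _.
  case: eqVneq => [->|vE]; last by rewrite big_pred0.
  by apply: eq_big => [e|e /eqP-> //]; rewrite eq_sym.
rewrite big_nat1_eq big_nat1_eq !ltnS (uphalf_cover_leq EG)
  (card_sub_edges_leq EG) /=.
(* The range of [e] is automatic, and the lower bound 2 on [v] says that [E] is nonempty, since one
   edge already covers two vertices. *)
suff -> : (E != set0) = (1 < #|cover E|)%N by rewrite andbC.
have [->|/set0Pn[f fE]] := eqVneq; first by rewrite /cover big_set0 cards0.
by rewrite -(card_edge (subsetP EG f fE)) subset_leq_card ?bigcup_sup.
Qed.
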